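(* Let $T$ be a competitive map on a rectangular set $\mathcal{R}\subset\mathbb{R}^2$ with an isolated fixed point $\overline{\mathrm{x}}\in\mathcal{R}$ such that $\mathcal{R}\cap\mathrm{int}\,(\mathcal{Q}_2(\overline{\mathrm{x}})\cup\mathcal{Q}_4(\overline{\mathrm{x}}))\neq\emptyset$. Suppose $T$ has a $C^1$ extension to a neighborhood of $\overline{\mathrm{x}}$. Let $\mathrm{v}=(\mathrm{v}^{(1)},\mathrm{v}^{(2)})\in\mathbb{R}^2$ be an eigenvector of the Jacobian of $T$ at $\overline{\mathrm{x}}$, with associated eigenvalue $\mu\in\mathbb{R}$. If $\mathrm{v}^{(1)}\mathrm{v}^{(2)}<0$, then there exists an order interval $\mathcal{I}$ which is also a relative neighborhood of $\overline{\mathrm{x}}$ such that for every relative neighborhood $\mathcal{U}\subset\mathcal{I}$ of $\overline{\mathrm{x}}$ the following statements are true. (i) If $\mu>1$, then $\mathcal{U}\cap\mathrm{int}\,\mathcal{Q}_2(\overline{\mathrm{x}})$ contains a subsolution and $\mathcal{U}\cap\mathrm{int}\,\mathcal{Q}_4(\overline{\mathrm{x}})$ contains a supersolution. In this case, for every $\mathrm{x}\in\mathcal{I}\cap\mathrm{int}\,(\mathcal{Q}_2(\overline{\mathrm{x}})\cup\mathcal{Q}_4(\overline{\mathrm{x}}))$ there exists $N$ such that $T^n(\mathrm{x})\notin\mathcal{I}$ for $n\ge N$. (ii) If $\mu<1$, then $\mathcal{U}\cap\mathrm{int}\,\mathcal{Q}_2(\overline{\mathrm{x}})$ contains a supersolution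 and $\mathcal{U}\cap\mathrm{int}\,\mathcal{Q}_4(\overline{\mathrm{x}})$ contains a subsolution. In this case $T^n(\mathrm{x})\to\overline{\mathrm{x}}$ for every $\mathrm{x}\in\mathcal{I}$.
   Context: A set $\mathcal{R}\subset\mathbb{R}^2$ is rectangular if it is the cartesian product of two intervals in $\mathbb{R}$. A map on $\mathcal{R}$ is a continuous function $T:\mathcal{R}\to\mathcal{R}$; write $T=(f,g)$. $T$ is competitive if $f(x,y)$ is non-decreasing in $x$ and non-increasing in $y$, and $g(x,y)$ is non-increasing in $x$ and non-decreasing in $y$. South-East order: $(x,y)\preceq_{se}(s,t)$ iff $x\le s$ and $y\ge t$. Quadrants: $\mathcal{Q}_2(x,y)=\{(u,v):u\le x,\ v\ge y\}$, $\mathcal{Q}_4(x,y)=\{(u,v):u\ge x,\ v\le y\}$. A point $\mathrm{x}$ is a subsolution if $T(\mathrm{x})\preceq_{se}\mathrm{x}$ and a supersolution if $\mathrm{x}\preceq_{se}T(\mathrm{x})$. An order interval is a set of the form $\{\mathrm{z}:\mathrm{a}\preceq_{se}\mathrm{z}\preceq_{se}\mathrm{b}\}$, i.e. the cartesian product of two compact intervals. ''Relative neighborhood'' means neighborhood in the relative topology of $\mathcal{R}$.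
   Formalization: The subsolution or supersolution in U ∩ int Q_2 (resp. U ∩ int Q_4) is claimed only if the rectangular set R meets int Q_2 (resp. int Q_4); otherwise it is false, e.g. R=[0,1]^2, fixed point (0,1), T(x,y)=(x/2,(1+y)/2). *)

(* Defs.v *)
From HB Require Import structures.
From mathcomp Require Export all_boot all_order all_algebra.
From mathcomp Require Export all_classical all_reals all_analysis.

Set Implicit Arguments.
Unset Strict Implicit.
Unset Printing Implicit Defensive.

Export Order.TTheory GRing.Theory Num.Theory.
Export numFieldNormedType.Exports.

Local Open Scope classical_set_scope.
Local Open Scope ring_scope.

(* Points of the plane are row vectors z : 'rV[R]_2 with coordinates z 0 0 and
   z 0 1; the topology of 'rV[R]_2 is the product topology. *)

Definition rectangular (R : realType) (D : set 'rV[R]_2) : Prop :=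
  exists I J : set R, [/\ is_interval I, is_interval J &
    D = [set z : 'rV[R]_2 | I (z 0 0) /\ J (z 0 1)]].

(* A self-map of D is a total function of the plane preserving D; its values
   outside D are irrelevant. *)
Definition map_on (R : realType) (D : set 'rV[R]_2)
    (T : 'rV[R]_2 -> 'rV[R]_2) : Prop :=
  (forall z, D z -> D (T z)) /\ {within D, continuous T}.

Definition competitive (R : realType) (D : set 'rV[R]_2)
    (T : 'rV[R]_2 -> 'rV[R]_2) : Prop :=
  (forall z w, D z -> D w -> z 0 0 <= w 0 0 -> z 0 1 = w 0 1 ->
     T z 0 0 <= T w 0 0 /\ T w 0 1 <= T z 0 1) /\
  (forall z w, D z -> D w -> z 0 0 = w 0 0 -> z 0 1 <= w 0 1 ->
     T w 0 0 <= T z 0 0 /\ T z 0 1 <= T w 0 1).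

Definition le_se (R : realType) (z w : 'rV[R]_2) : Prop :=
  z 0 0 <= w 0 0 /\ w 0 1 <= z 0 1.

Definition quadrant2 (R : realType) (p : 'rV[R]_2) : set 'rV[R]_2 :=
  [set z | z 0 0 <= p 0 0 /\ p 0 1 <= z 0 1].

Definition quadrant4 (R : realType) (p : 'rV[R]_2) : set 'rV[R]_2 :=
  [set z | p 0 0 <= z 0 0 /\ z 0 1 <= p 0 1].

Definition subsolution (R : realType) (T : 'rV[R]_2 -> 'rV[R]_2)
    (z : 'rV[R]_2) : Prop := le_se (T z) z.

Definition supersolution (R : realType) (T : 'rV[R]_2 -> 'rV[R]_2)
    (z : 'rV[R]_2) : Prop := le_se z (T z).

Definition order_interval (R : realType) (I : set 'rV[R]_2) : Prop :=
  exists a b : 'rV[R]_2, I = [set z | le_se a z /\ le_se z b].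

Definition relative_nbhs (R : realType) (D : set 'rV[R]_2) (p : 'rV[R]_2)
    (U : set 'rV[R]_2) : Prop :=
  U `<=` D /\ within D (nbhs p) U.

Definition isolated_fixed_point (R : realType) (D : set 'rV[R]_2)
    (T : 'rV[R]_2 -> 'rV[R]_2) (p : 'rV[R]_2) : Prop :=
  isolated [set z | D z /\ T z = z] p.

Definition C1_on (R : realType) (V : set 'rV[R]_2)
    (F : 'rV[R]_2 -> 'rV[R]_2) : Prop :=
  forall z, V z -> differentiable F z /\ {for z, continuous (jacobian F)}.

Definition C1_extension_near (R : realType) (D : set 'rV[R]_2)
    (T : 'rV[R]_2 -> 'rV[R]_2) (p : 'rV[R]_2)
    (F : 'rV[R]_2 -> 'rV[R]_2) : Prop :=
  exists V : set 'rV[R]_2, [/\ open V, V p, C1_on V F &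
    forall z, V z -> D z -> F z = T z].

(* [jacobian F p] acts on row vectors on the right: [v *m jacobian F p] is the
   differential of F at p applied to v.  It is the transpose of the matrix of
   partial derivatives acting on columns, so the usual (column) eigenvectors of
   the latter are exactly the row vectors v below. *)
Definition jacobian_eigenvector (R : realType) (F : 'rV[R]_2 -> 'rV[R]_2)
    (p v : 'rV[R]_2) (mu : R) : Prop :=
  v != 0 /\ (v <= eigenspace (jacobian F p) mu)%MS.

(* Main.v *)
(* Let d be the eigenvector oriented into the south-east quadrant, and consider
   the orders [cone_le (+/- d)], which T preserves.  Along the ray p + t d one has
   T (p + t d) - (p + t d) = t (mu - 1) d + o(t), so that for small t these
   points are super- or subsolutions, and a monotone orbit that stays in a
   compact order interval around p free of other fixed points converges to p.
   When mu > 1 the orbit of p + t d moves away from p, so it leaves the interval,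
   and so does every orbit dominating it.  When mu < 1 the orbits of the two
   corners of the interval converge to p and squeeze all the others.

   The point p may lie on the boundary of D, and then p + t d need not belong to
   D.  The corners are therefore taken along d with the blocked coordinates set
   to 0 ([clip]); they are still pushed towards p because the off-diagonal
   entries of the Jacobian are nonpositive. *)

Require Import Defs.
From mathcomp Require Import all_boot all_order all_algebra.
From mathcomp Require Import all_classical all_reals all_analysis.
From mathcomp Require Import lra.

Set Implicit Arguments.
Unset Strict Implicit.
Unset Printing Implicit Defensive.

Local Open Scope classical_set_scope.
Local Open Scope ring_scope.

(** * Neighbourhoods and limits in the plane, coordinate by coordinate *)

Lemma forall_ord2 (P : 'I_2 -> Prop) : P 0 -> P 1 -> forall i, P i.
Proof.
move=> P0 P1 [[|[|//]] lti].
- by rewrite (_ : Ordinal lti = 0) //; exact: val_inj.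
- by rewrite (_ : Ordinal lti = 1) //; exact: val_inj.
Qed.

Lemma nbhs_rV2P (R : realType) (p : 'rV[R]_2) (W : set 'rV[R]_2) :
  nbhs p W <-> exists2 e : R, 0 < e &
    forall x : 'rV[R]_2, (forall i, `|x 0 i - p 0 i| < e) -> W x.
Proof.
split=> [/nbhs_ballP[e /= e0 eW]|[e e0 eW]].
  exists e => // x hx; apply: eW; split=> // i j.
  by rewrite ord1 -ball_normE /= distrC; exact: hx.
apply/nbhs_ballP; exists e => //= x [_ hx]; apply: eW => i.
by have := hx 0 i; rewrite -ball_normE /= distrC.
Qed.

Lemma cvg_rV2 (R : realType) (u : nat -> 'rV[R]_2) (l : 'rV[R]_2) :
  (forall i, u n 0 i @[n --> \oo] --> l 0 i) -> u n @[n --> \oo] --> l.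
Proof.
move=> ul; apply/cvg_ballP => e e0.
have : \forall n \near \oo, forall i, ball (l 0 i) e (u n 0 i).
  by apply: filter_forall => i; exact: (cvg_ball (ul i)).
by apply: filterS => n hn; split=> // i j; rewrite ord1; exact: hn.
Qed.

Lemma cvg_coord (R : realType) (u : nat -> 'rV[R]_2) (l : 'rV[R]_2) i :
  u n @[n --> \oo] --> l -> u n 0 i @[n --> \oo] --> l 0 i.
Proof.
by move=> ul; apply: (continuous_cvg _ (@coord_continuous R 1 2 0 i l)).
Qed.

(** * Rays from a point and directional derivatives *)

Lemma ray_coord (R : realType) (p d : 'rV[R]_2) (t : R) i :
  (p + t *: d) 0 i = p 0 i + t * d 0 i.
Proof. by rewrite !mxE. Qed.

Lemma nbhs_ray (R : realType) (p d : 'rV[R]_2) (W : set 'rV[R]_2) :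
  nbhs p W -> \forall t \near 0^'+, W (p + t *: d).
Proof.
move=> /nbhs_rV2P[e e0 eW].
have : \forall t \near (0 : R)^'+, forall i, `|t * d 0 i| < e.
  apply: filter_forall => i.
  (* Adding 1 avoids a division by zero, since a clipped direction can have a zero coordinate. *)
  have he : 0 < e / (1 + `|d 0 i|) by rewrite divr_gt0// ltr_pwDl.
  near=> t.
  have t0 : 0 < t by near: t; exact: nbhs_right_gt.
  rewrite normrM gtr0_norm //.
  have : t < e / (1 + `|d 0 i|) by near: t; exact: nbhs_right_lt.
  rewrite ltr_pdivlMr ?ltr_pwDl //; apply: le_lt_trans.
  by rewrite ler_pM2l// lerDr.
apply: filterS => t ht; apply: eW => i.
by rewrite ray_coord addrAC subrr add0r.
Unshelve. all: by end_near. Qed.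

(** The difference quotients along [d] tend to the directional derivative, so a strict bound on the
    limit holds for small t. The factor [s] carries a sign: a negative [s] turns the estimate into a
    lower bound. *)
Lemma directional_upper_bound (R : realType) (F : 'rV[R]_2 -> 'rV[R]_2)
    (p d : 'rV[R]_2) (s c : R) (i : 'I_2) :
  differentiable F p -> s * (d *m jacobian F p) 0 i < c ->
  \forall t \near 0^'+, s * (F (p + t *: d) 0 i - F p 0 i) < t * c.
Proof.
move=> dF; rewrite -deriveEjacobian // => sc.
have hlim : h^-1 *: (F (p + h *: d) - F p) @[h --> 0^'+] --> 'D_d F p.
  apply: cvg_dnbhs_at_right.
  rewrite (_ : (fun h => _) =
      (fun h => h^-1 *: ((F \o shift p) (h *: d) - F p))); last first.
    by apply/funext => h; rewrite /= [p + _]addrC.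
  exact: diff_derivable.
have hi : s * (h^-1 *: (F (p + h *: d) - F p)) 0 i @[h --> 0^'+] -->
    s * ('D_d F p) 0 i.
  apply: cvgMl_tmp.
  exact: (continuous_cvg _ (@coord_continuous R 1 2 0 i ('D_d F p))).
near=> t.
have t0 : 0 < t by near: t; exact: nbhs_right_gt.
have : s * (t^-1 *: (F (p + t *: d) - F p)) 0 i < c.
  by near: t; exact: (cvgr_lt _ hi _ sc).
by rewrite !mxE mulrCA ltr_pdivrMl.
Unshelve. all: by end_near. Qed.

(** * Orders attached to a direction, and monotonicity of competitive maps *)

(** Only the signs of [d] matter: for [d] in the open south-east quadrant this is [le_se], and [- d]
    gives the reverse order. An argument for the fourth quadrant thus covers the second one on
    replacing [d] by [- d]. *)
Definition cone_le (R : realType) (d z w : 'rV[R]_2) : Prop :=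
  forall i, d 0 i * z 0 i <= d 0 i * w 0 i.

Lemma cone_le_trans (R : realType) (d y z w : 'rV[R]_2) :
  cone_le d y z -> cone_le d z w -> cone_le d y w.
Proof. by move=> yz zw i; exact: le_trans (yz i) (zw i). Qed.

Lemma cone_leN (R : realType) (d z w : 'rV[R]_2) :
  cone_le (- d) z w <-> cone_le d w z.
Proof. by split=> h i; have := h i; rewrite !mxE !mulNr lerN2. Qed.

Lemma cone_le_se (R : realType) (d z w : 'rV[R]_2) :
  0 < d 0 0 -> d 0 1 < 0 -> cone_le d z w <-> le_se z w.
Proof.
move=> d0 d1; split=> [h|[h0 h1]].
  by split; [have := h 0; rewrite ler_pM2l|have := h 1; rewrite ler_nM2l].
by apply: forall_ord2; [rewrite ler_pM2l|rewrite ler_nM2l].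
Qed.

(** The sign condition makes the order [le_se] or its reverse. For [le_se], one coordinate changes
    at a time through the corner [m], which lies in [D] because [D] is a product; each move uses one
    clause of [competitive]. *)
Lemma cone_le_competitive (R : realType) (D : set 'rV[R]_2) T (d z w : 'rV[R]_2) :
  rectangular D -> competitive D T -> d 0 0 * d 0 1 < 0 ->
  D z -> D w -> cone_le d z w -> cone_le d (T z) (T w).
Proof.
move=> [I [J [_ _ DE]]] [mono0 mono1].
have se_mono y x : D y -> D x -> le_se y x -> le_se (T y) (T x).
  move=> Dy Dx [yx0 yx1].
  pose m : 'rV[R]_2 := \row_i if i == 0 then x 0 0 else y 0 1.
  have m0 : m 0 0 = x 0 0 by rewrite mxE.
  have m1 : m 0 1 = y 0 1 by rewrite mxE.
  have Dm : D m.
    by move: Dy Dx; rewrite DE /= => -[_ ?] [? _]; rewrite m0 m1.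
  have [||a b] := mono0 y m Dy Dm; rewrite ?m0 ?m1//.
  have [||a' b'] := mono1 x m Dx Dm; rewrite ?m0 ?m1//.
  by split; [exact: le_trans a a'|exact: le_trans b' b].
move=> dneg Dz Dw.
have [d0|d0|d0] := ltgtP (d 0 0) 0.
- have d1 : 0 < d 0 1 by rewrite -(nmulr_rlt0 _ d0).
  rewrite -!(cone_leN d) !cone_le_se ?mxE ?oppr_gt0 ?oppr_lt0//.
  exact: se_mono.
- have d1 : d 0 1 < 0 by rewrite -(pmulr_rlt0 _ d0).
  by rewrite !cone_le_se//; exact: se_mono.
- by move: dneg; rewrite d0 mul0r ltxx.
Qed.

Lemma competitive_offdiag (R : realType) (D : set 'rV[R]_2) T (i j : 'I_2)
    (z w : 'rV[R]_2) : competitive D T -> i != j -> D z -> D w ->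
  z 0 i <= w 0 i -> z 0 j = w 0 j -> T w 0 j <= T z 0 j.
Proof.
move=> [mono0 mono1]; elim/forall_ord2: i; elim/forall_ord2: j => //
  _ Dz Dw h1 h2.
- by have [] := mono0 z w.
- by have [] := mono1 z w.
Qed.

Lemma rectangular_between (R : realType) (D : set 'rV[R]_2) (x : 'rV[R]_2) :
  rectangular D ->
  (forall i, exists y w, [/\ D y, D w & y 0 i <= x 0 i <= w 0 i]) -> D x.
Proof.
move=> [I [J [Ii Ji DE]]] h; rewrite DE /=; split.
- have [y [w [+ + xi]]] := h 0; rewrite DE /= => -[Iy _] [Iw _].
  exact: Ii Iy Iw _ xi.
- have [y [w [+ + xi]]] := h 1; rewrite DE /= => -[_ Jy] [_ Jw].
  exact: Ji Jy Jw _ xi.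
Qed.

(** * Directions clipped to the domain *)

Definition clip (R : realType) (D : set 'rV[R]_2) (p d : 'rV[R]_2) : 'rV[R]_2 :=
  \row_i if `[< exists2 z, D z & 0 < d 0 i * (z 0 i - p 0 i) >]
         then d 0 i else 0.

Lemma clipP (R : realType) (D : set 'rV[R]_2) (p d : 'rV[R]_2) i :
  (clip D p d 0 i = d 0 i /\ exists2 z, D z & 0 < d 0 i * (z 0 i - p 0 i)) \/
  (clip D p d 0 i = 0 /\ forall z, D z -> d 0 i * (z 0 i - p 0 i) <= 0).
Proof.
rewrite mxE; case: ifPn => /asboolP h; [by left|right; split=> // z Dz].
by rewrite leNgt; apply/negP => hz; apply: h; exists z.
Qed.

Lemma clip_id (R : realType) (D : set 'rV[R]_2) (p d x : 'rV[R]_2) :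
  D x -> (forall i, 0 < d 0 i * (x 0 i - p 0 i)) -> clip D p d = d.
Proof.
move=> Dx hx; apply/rowP => i; have [[]//|[_ /(_ x Dx)]] := clipP D p d i.
by rewrite leNgt hx.
Qed.

(** A blocked coordinate stays at that of [p]; a free one stays between those of [p] and of its
    witness [z] for small t. The witnesses may differ by coordinate because [D] is a product of
    intervals. *)
Lemma clip_ray_in (R : realType) (D : set 'rV[R]_2) (p d : 'rV[R]_2) :
  rectangular D -> D p -> \forall t \near 0^'+, D (p + t *: clip D p d).
Proof.
move=> rD Dp.
have : \forall t \near (0 : R)^'+, forall i, exists y w, [/\ D y, D w &
    y 0 i <= (p + t *: clip D p d) 0 i <= w 0 i].
  apply: filter_forall => i; rewrite /=.
  have [[ci [z Dz hz]]|[ci _]] := clipP D p d i; last first.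
    near=> t; exists p, p; split=> //.
    by rewrite ray_coord ci mulr0 addr0 lexx.
  (* The threshold is (z_i - p_i) / d_i, expanded by d_i so that numerator and denominator are
     positive whatever the sign of d_i. *)
  have t1 : 0 < (d 0 i * (z 0 i - p 0 i)) / (d 0 i ^+ 2).
    rewrite divr_gt0// exprn_even_gt0//=; apply: contraTneq hz => ->.
    by rewrite mul0r ltxx.
  have dn0 : d 0 i != 0 by apply: contraTneq hz => ->; rewrite mul0r ltxx.
  have d2 : 0 < d 0 i ^+ 2 by rewrite exprn_even_gt0.
  near=> t.
  have t0 : 0 < t by near: t; exact: nbhs_right_gt.
  have : t < (d 0 i * (z 0 i - p 0 i)) / (d 0 i ^+ 2).
    by near: t; exact: nbhs_right_lt.
  rewrite ltr_pdivlMr// => tlt.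
  have -> : (p + t *: clip D p d) 0 i = p 0 i + t * d 0 i.
    by rewrite ray_coord ci.
  have [dp|dN|d0] := ltgtP (d 0 i) 0; last by rewrite d0 eqxx in dn0.
  - exists z, p; split=> //; apply/andP; split; last first.
      by rewrite gerDl pmulr_rle0 // ltW.
    by rewrite -(ler_nM2l dp); nra.
  - exists p, z; split=> //; apply/andP; split.
      by rewrite lerDl pmulr_rge0 // ltW.
    by rewrite -(ler_pM2l dN); nra.
by apply: filterS => t ht; exact: rectangular_between ht.
Unshelve. all: by end_near. Qed.

(** * Signs of the Jacobian and the motion of ray points under the map *)

(** If the entry were positive, a small move from [p] along axis [i] would shift coordinate [j] of
    [T] the same way, while [competitive] forbids this. Since [F] agrees with [T] only on [D], the
    move must stay in [D], which [z] permits. *)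
Lemma jacobian_offdiag_le0 (R : realType) (D V : set 'rV[R]_2) T F
    (p : 'rV[R]_2) (i j : 'I_2) :
  rectangular D -> competitive D T -> D p -> differentiable F p ->
  nbhs p V -> (forall z, V z -> D z -> F z = T z) ->
  i != j -> (exists2 z, D z & z 0 i != p 0 i) -> jacobian F p i j <= 0.
Proof.
move=> rD cT Dp dF nV FT ij [z Dz zi]; rewrite leNgt; apply/negP => A0.
(* [d] points along axis [i] towards [z], so clipping leaves it unchanged and its ray starts inside
   [D]. *)
pose s := z 0 i - p 0 i; pose d : 'rV[R]_2 := s *: delta_mx 0 i.
have s2 : 0 < s * s by rewrite -expr2 exprn_even_gt0//= subr_eq0.
have di : d 0 i = s by rewrite !mxE !eqxx mulr1.
have dj k : k != i -> d 0 k = 0.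
  by rewrite !mxE eqxx /= => /negPf ->; rewrite mulr0.
have cd : clip D p d = d.
  apply/rowP => k; have [[]//|[-> h]] := clipP D p d k.
  have [ki|ki] := eqVneq k i; last by rewrite dj.
  by have := h z Dz; rewrite ki di leNgt s2.
have dA : (d *m jacobian F p) 0 j = s * jacobian F p i j.
  by rewrite -scalemxAl mxE -rowE mxE.
have key : - s * (d *m jacobian F p) 0 j < 0 by rewrite dA; nra.
have : \forall t \near (0 : R)^'+, False.
  near=> t.
  have t0 : 0 < t by near: t; exact: nbhs_right_gt.
  have Dt : D (p + t *: d) by rewrite -cd; near: t; exact: clip_ray_in.
  have Vt : V (p + t *: d) by near: t; exact: nbhs_ray.
  have : - s * (F (p + t *: d) 0 j - F p 0 j) < t * 0.
    by near: t; exact: directional_upper_bound.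
  rewrite !FT//; last exact: nbhs_singleton.
  have ti : (p + t *: d) 0 i = p 0 i + t * s by rewrite ray_coord di.
  have tj : (p + t *: d) 0 j = p 0 j.
    by rewrite ray_coord dj ?mulr0 ?addr0// eq_sym.
  have [s0|s0|s0] := ltgtP s 0.
  - have := competitive_offdiag cT ij Dt Dp; rewrite ti tj => /(_ _ erefl).
    by move=> H; have {}H := H ltac:(nra); nra.
  - have := competitive_offdiag cT ij Dp Dt; rewrite ti tj => /(_ _ erefl).
    by move=> H; have {}H := H ltac:(nra); nra.
  - by move: s2; rewrite s0 mulr0 ltxx.
by move/filter_ex => [].
Unshelve. all: by end_near. Qed.

Lemma offdiag_mul_lt0 (R : realType) (d : 'rV[R]_2) (i k : 'I_2) :
  d 0 0 * d 0 1 < 0 -> i != k -> d 0 i * d 0 k < 0.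
Proof. by elim/forall_ord2: i; elim/forall_ord2: k => // h _; rewrite mulrC. Qed.

Lemma coord_neq0 (R : realType) (d : 'rV[R]_2) (i : 'I_2) :
  d 0 0 * d 0 1 < 0 -> d 0 i != 0.
Proof.
by elim/forall_ord2: i => h; apply: contraTneq h => ->;
  rewrite ?mul0r ?mulr0 ltxx.
Qed.

(** A blocked coordinate cannot pass [p] because [T] preserves [D]. In a free coordinate the
    eigenvalue estimate survives clipping thanks to the sign of the off-diagonal entries, and mu < 1
    makes it strict. *)
Lemma clip_ray_contracted (R : realType) (D V : set 'rV[R]_2) T F
    (p d : 'rV[R]_2) (mu : R) :
  rectangular D -> competitive D T -> (forall z, D z -> D (T z)) ->
  D p -> T p = p -> differentiable F p ->
  nbhs p V -> (forall z, V z -> D z -> F z = T z) ->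
  (forall i, exists2 z, D z & z 0 i != p 0 i) ->
  d *m jacobian F p = mu *: d -> d 0 0 * d 0 1 < 0 -> mu < 1 ->
  \forall t \near 0^'+,
    cone_le d (T (p + t *: clip D p d)) (p + t *: clip D p d).
Proof.
move=> rD cT DT Dp Tp dF nV FT nd dA dneg mu1.
have Fp : F p = p by rewrite FT//; exact: nbhs_singleton.
apply: filter_forall => i; set u := clip D p d.
have [[ui _]|[ui hi]] := clipP D p d i; rewrite -/u in ui; last first.
  near=> t.
  have Dt : D (p + t *: u) by near: t; exact: clip_ray_in.
  rewrite ray_coord ui mulr0 addr0.
  by have := hi _ (DT _ Dt); nra.
(* Clipping changes the other coordinate [k] by 0 or - d_k, whose product with d_i is nonnegative;
   multiplied by a nonpositive Jacobian entry, it can only lower the term mu d_i^2. *)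
have uA : d 0 i * (u *m jacobian F p) 0 i <= mu * d 0 i ^+ 2.
  rewrite -[u](subrK d) mulmxDl dA mxE [(mu *: d) 0 i]mxE mulrDr.
  suff : d 0 i * ((u - d) *m jacobian F p) 0 i <= 0 by nra.
  rewrite mxE mulr_sumr; apply: sumr_le0 => k _.
  have -> : (u - d) 0 k = u 0 k - d 0 k by rewrite [LHS]mxE [X in _ + X]mxE.
  rewrite mulrA.
  have [<-|ik] := eqVneq i k; first by rewrite ui subrr mulr0 mul0r.
  rewrite mulr_ge0_le0//; last first.
    by apply: (jacobian_offdiag_le0 rD cT Dp dF nV FT); rewrite 1?eq_sym.
  have := offdiag_mul_lt0 dneg ik.
  by have [[-> _]|[-> _]] := clipP D p d k; nra.
have d2 : 0 < d 0 i ^+ 2 by rewrite exprn_even_gt0//= coord_neq0.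
near=> t.
have Dt : D (p + t *: u) by near: t; exact: clip_ray_in.
have Vt : V (p + t *: u) by near: t; exact: nbhs_ray.
have : d 0 i * (F (p + t *: u) 0 i - F p 0 i) < t * d 0 i ^+ 2.
  near: t; apply: directional_upper_bound => //.
  by apply: le_lt_trans uA _; rewrite gtr_pMl.
rewrite Fp FT// ray_coord ui; nra.
Unshelve. all: by end_near. Qed.

(** The lower bound comes from the factor - d_i with c = - d_i^2, where mu > 1 gives strictness. The
    direction is unclipped because clipping preserves only upper bounds on the displacement. *)
Lemma ray_expanded (R : realType) (D V : set 'rV[R]_2) T F
    (p d : 'rV[R]_2) (mu : R) :
  rectangular D -> D p -> T p = p -> differentiable F p ->
  nbhs p V -> (forall z, V z -> D z -> F z = T z) ->
  d *m jacobian F p = mu *: d -> d 0 0 * d 0 1 < 0 -> 1 < mu ->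
  clip D p d = d ->
  \forall t \near 0^'+, cone_le d (p + t *: d) (T (p + t *: d)).
Proof.
move=> rD Dp Tp dF nV FT dA dneg mu1 cd.
have Fp : F p = p by rewrite FT//; exact: nbhs_singleton.
apply: filter_forall => i.
have d2 : 0 < d 0 i ^+ 2 by rewrite exprn_even_gt0//= coord_neq0.
near=> t.
have Dt : D (p + t *: d) by rewrite -cd; near: t; exact: clip_ray_in.
have Vt : V (p + t *: d) by near: t; exact: nbhs_ray.
have : - d 0 i * (F (p + t *: d) 0 i - F p 0 i) < t * - d 0 i ^+ 2.
  near: t; apply: directional_upper_bound => //.
  by rewrite dA mxE; nra.
rewrite Fp FT// ray_coord; nra.
Unshelve. all: by end_near. Qed.

(** * Order intervals around the fixed point *)

Definition cone_box (R : realType) (d a b : 'rV[R]_2) : set 'rV[R]_2 :=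
  [set x | cone_le d a x /\ cone_le d x b].

Lemma cone_boxN (R : realType) (d a b : 'rV[R]_2) :
  cone_box (- d) b a = cone_box d a b.
Proof. by apply/seteqP; split=> x [/cone_leN h1 /cone_leN h2]; split. Qed.

Lemma cone_box_sub (R : realType) (D : set 'rV[R]_2) (d a b : 'rV[R]_2) :
  rectangular D -> (forall i, d 0 i != 0) -> D a -> D b -> cone_box d a b `<=` D.
Proof.
move=> rD dn0 Da Db x [ax xb]; apply: rectangular_between => // i.
have := ax i; have := xb i.
have [di|di|di] := ltgtP (d 0 i) 0; last by have := dn0 i; rewrite di eqxx.
- by rewrite !ler_nM2l// => ? ?; exists b, a; split=> //; apply/andP.
- by rewrite !ler_pM2l// => ? ?; exists a, b; split=> //; apply/andP.
Qed.

(** On a free side the corner leaves a margin t d_i^2 in the weighted coordinate; on a blocked side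
    [D] itself does not go past [p]. The claim [half] treats one corner and is used for both [d] and
    [- d]. *)
Lemma relative_nbhs_clip_box (R : realType) (D : set 'rV[R]_2)
    (p d : 'rV[R]_2) (t : R) :
  (forall i, d 0 i != 0) -> 0 < t ->
  cone_box d (p + t *: clip D p (- d)) (p + t *: clip D p d) `<=` D ->
  relative_nbhs D p (cone_box d (p + t *: clip D p (- d)) (p + t *: clip D p d)).
Proof.
move=> dn0 t0 bD; split=> //.
have half (e : 'rV[R]_2) : (forall i, e 0 i != 0) -> \forall x \near p,
    D x -> cone_le e x (p + t *: clip D p e).
  move=> en0.
  have : \forall x \near p, forall i,
      D x -> e 0 i * x 0 i <= e 0 i * (p + t *: clip D p e) 0 i.
    apply: (@filter_forall _ _ _ _ (nbhs_filter p)) => i.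
    have e2 : 0 < e 0 i * e 0 i by rewrite -expr2 exprn_even_gt0//= en0.
    have [[ci _]|[ci hi]] := clipP D p e i; last first.
      near=> x => Dx; rewrite ray_coord ci.
      by have := hi x Dx; nra.
    have ex : e 0 i * x 0 i @[x --> p] --> e 0 i * p 0 i.
      by apply: cvgMl_tmp; exact: coord_continuous.
    near=> x => _; rewrite ray_coord ci.
    have : e 0 i * x 0 i < e 0 i * p 0 i + t * (e 0 i * e 0 i).
      by near: x; apply: (cvgr_lt _ ex); rewrite ltrDl mulr_gt0.
    by move/ltW/le_trans; apply; nra.
  by apply: filterS => x hx Dx i; exact: hx.
have dNn0 i : (- d) 0 i != 0 by rewrite mxE oppr_eq0.
rewrite /within /=; near=> x.
have hm : D x -> cone_le (- d) x (p + t *: clip D p (- d)).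
  by near: x; exact: half.
have hp : D x -> cone_le d x (p + t *: clip D p d) by near: x; exact: half.
by move=> Dx; split; [apply/cone_leN; exact: hm|exact: hp].
Unshelve. all: by end_near. Qed.

Lemma near_clip_box_sub (R : realType) (D W : set 'rV[R]_2) (p d : 'rV[R]_2) :
  (forall i, d 0 i != 0) -> nbhs p W ->
  \forall t \near 0^'+,
    cone_box d (p + t *: clip D p (- d)) (p + t *: clip D p d) `<=` W.
Proof.
move=> dn0 /nbhs_rV2P[e e0 eW].
have : \forall t \near (0 : R)^'+, forall i, t * `|d 0 i| < e.
  apply: filter_forall => i; near=> t.
  have t0 : 0 < t by near: t; exact: nbhs_right_gt.
  rewrite -ltr_pdivlMr ?normr_gt0//; near: t.
  by apply: nbhs_right_lt; rewrite divr_gt0// normr_gt0.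
move=> te; near=> t => x [ax xb]; apply: eW => i.
have t0 : 0 < t by near: t; exact: nbhs_right_gt.
have ti : t * `|d 0 i| < e by move: i {ax xb}; near: t.
apply: le_lt_trans ti.
have d2 : 0 < d 0 i ^+ 2 by rewrite exprn_even_gt0//= dn0.
(* In weighted coordinates the box extends at most t d_i^2 on either side of [p]; dividing by the
   absolute value of d_i gives the desired radius. *)
have clip_le : - (d 0 i ^+ 2) <= d 0 i * clip D p (- d) 0 i /\
    d 0 i * clip D p d 0 i <= d 0 i ^+ 2.
  split; [have := clipP D p (- d) i|have := clipP D p d i];
    rewrite ?[(- d) 0 i]mxE; by case=> -[-> _]; nra.
move: clip_le => [lo hi].
have dp : 0 < `|d 0 i| by rewrite normr_gt0.
rewrite -(ler_pM2l dp) -normrM.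
have -> : `|d 0 i| * (t * `|d 0 i|) = t * d 0 i ^+ 2.
  by rewrite mulrCA -expr2 real_normK// num_real.
have := ax i; have := xb i; rewrite !ray_coord ler_norml => H1 H2.
apply/andP; split; nra.
Unshelve. all: by end_near. Qed.

(** * Monotone orbits *)

Lemma iter_in (A : Type) (D : set A) (T : A -> A) (n : nat) (z : A) :
  (forall z, D z -> D (T z)) -> D z -> D (iter n T z).
Proof. by move=> DT Dz; elim: n => //= n; exact: DT. Qed.

Lemma iter_cone_le (R : realType) (D : set 'rV[R]_2) T (d z w : 'rV[R]_2)
    (n : nat) :
  (forall z, D z -> D (T z)) ->
  (forall z w, D z -> D w -> cone_le d z w -> cone_le d (T z) (T w)) ->
  D z -> D w -> cone_le d z w -> cone_le d (iter n T z) (iter n T w).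
Proof.
by move=> DT mT Dz Dw zw; elim: n => //= n; apply: mT; exact: iter_in.
Qed.

Lemma iter_cone_homo (R : realType) (D : set 'rV[R]_2) T (d z : 'rV[R]_2) :
  (forall z, D z -> D (T z)) ->
  (forall z w, D z -> D w -> cone_le d z w -> cone_le d (T z) (T w)) ->
  D z -> cone_le d z (T z) ->
  forall m n, (m <= n)%N -> cone_le d (iter m T z) (iter n T z).
Proof.
move=> DT mT Dz zT m n /subnK <-; elim: (n - m)%N => [//|k IH].
apply: cone_le_trans IH _; rewrite addSn [iter _.+1 _ _]iterSr.
by apply: (iter_cone_le _ DT mT) => //; exact: DT.
Qed.

(** The weighted coordinates are nondecreasing and bounded by those of [b], hence converge. The box
    is closed, so the limit lies in [D], and continuity of [T] there makes it fixed. *)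
Lemma increasing_orbit_cvg (R : realType) (D : set 'rV[R]_2) T
    (d a b z : 'rV[R]_2) :
  (forall i, d 0 i != 0) -> {within D, continuous T} ->
  cone_box d a b `<=` D -> (forall n, cone_box d a b (iter n T z)) ->
  (forall m n, (m <= n)%N -> cone_le d (iter m T z) (iter n T z)) ->
  exists2 l, iter n T z @[n --> \oo] --> l &
    [/\ cone_box d a b l, T l = l & forall n, cone_le d (iter n T z) l].
Proof.
move=> dn0 cT bD zb zinc.
pose s i n := d 0 i * (iter n T z) 0 i.
have s_inc i : {homo s i : m n / (m <= n)%N >-> m <= n}.
  by move=> m n mn; exact: zinc.
have s_cvg i : cvgn (s i).
  apply: nondecreasing_is_cvgn => //.
  by exists (d 0 i * b 0 i) => _ [n _ <-]; exact: (zb n).2.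
pose l : 'rV[R]_2 := \row_i ((d 0 i)^-1 * limn (s i)).
have dl i : d 0 i * l 0 i = limn (s i) by rewrite mxE mulVKf.
have ul : iter n T z @[n --> \oo] --> l.
  apply: cvg_rV2 => i; rewrite mxE.
  rewrite (_ : (fun n => _) = (fun n => (d 0 i)^-1 * s i n)).
    by apply: cvgMl_tmp; exact: s_cvg.
  by apply/funext => n; rewrite /s mulKf.
have zl n : cone_le d (iter n T z) l.
  by move=> i; rewrite dl; exact: nondecreasing_cvgn_le.
have bl : cone_box d a b l.
  split; first exact: cone_le_trans (zb 0).1 (zl 0).
  move=> i; rewrite dl; apply: limr_le; first exact: s_cvg.
  by apply: nearW => n; exact: (zb n).2.
exists l => //; split=> //.
have Tul : T (iter n T z) @[n --> \oo] --> T l.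
  (* [T] is continuous only relative to [D], so membership of the orbit in [D] is discharged at each
     index. *)
  have /subspace_continuousP/(_ l (bD _ bl)) cTl := cT.
  apply: cvg_trans cTl => W /= hW.
  have Wn : \forall n \near \oo, D (iter n T z) -> W (T (iter n T z)).
    exact: (ul _ hW).
  suff : \forall n \near \oo, W (T (iter n T z)) by [].
  by apply: filterS Wn => n; apply; apply: bD.
apply: (cvg_unique (@norm_hausdorff _ _)) Tul _.
by move: ul; rewrite -cvg_shiftS.
Qed.

(** If the orbit of [z] stayed in the box, its limit would be the fixed point [p], and [z] would lie
    both above and below [p]. Since the orbit stays above [a], it exits by failing to be below [b],
    and this failure passes to all later iterates and to every orbit starting above [z]. *)
Lemma increasing_orbit_leaves (R : realType) (D : set 'rV[R]_2) T
    (d a b p z x : 'rV[R]_2) :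
  (forall i, d 0 i != 0) -> {within D, continuous T} ->
  (forall z, D z -> D (T z)) ->
  (forall z w, D z -> D w -> cone_le d z w -> cone_le d (T z) (T w)) ->
  cone_box d a b `<=` D -> (forall l, cone_box d a b l -> T l = l -> l = p) ->
  cone_le d a p -> cone_le d p z -> z <> p -> D z -> cone_le d z (T z) ->
  D x -> cone_le d z x ->
  exists N : nat, forall n : nat, (N <= n)%N -> ~ cone_box d a b (iter n T x).
Proof.
move=> dn0 cT DT mT bD fixb ap pz zp Dz zT Dx zx.
have zinc := iter_cone_homo DT mT Dz zT.
have az n : cone_le d a (iter n T z).
  by apply: cone_le_trans ap (cone_le_trans pz _); exact: (zinc 0).
have [N hN] : exists N, ~ cone_box d a b (iter N T z).
  apply/not_existsP => zb.
  have {}zb n : cone_box d a b (iter n T z) by exact: contrapT.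
  have [l _ [bl Tl zl]] := increasing_orbit_cvg dn0 cT bD zb zinc.
  have lp := fixb l bl Tl; apply: zp; apply/rowP => i.
  by apply: (mulfI (dn0 i)); apply: le_anti; rewrite pz -lp (zl 0).
exists N => n Nn [_ xb]; apply: hN; split=> //.
apply: cone_le_trans xb; apply: cone_le_trans (zinc _ _ Nn) _.
exact: (iter_cone_le _ DT mT).
Qed.

(** The constant orbit of [p] bounds that of [a] from above and keeps it in the box, where [p] is
    the only possible limit. *)
Lemma increasing_orbit_cvg_fix (R : realType) (D : set 'rV[R]_2) T
    (d a b p : 'rV[R]_2) :
  (forall i, d 0 i != 0) -> {within D, continuous T} ->
  (forall z, D z -> D (T z)) ->
  (forall z w, D z -> D w -> cone_le d z w -> cone_le d (T z) (T w)) ->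
  cone_box d a b `<=` D -> (forall l, cone_box d a b l -> T l = l -> l = p) ->
  cone_box d a b p -> T p = p -> cone_le d a (T a) ->
  iter n T a @[n --> \oo] --> p.
Proof.
move=> dn0 cT DT mT bD fixb [ap pb] Tp aT.
have Da : D a by apply: bD; split=> //; exact: cone_le_trans ap pb.
have Dp : D p by apply: bD.
have ainc := iter_cone_homo DT mT Da aT.
have ab n : cone_box d a b (iter n T a).
  split; first exact: (ainc 0).
  apply: cone_le_trans pb; rewrite -(_ : iter n T p = p); last first.
    by elim: n => //= n ->.
  exact: (iter_cone_le _ DT mT).
have [l al [bl Tl _]] := increasing_orbit_cvg dn0 cT bD ab ainc.
by rewrite -(fixb l bl Tl).
Qed.

(** * Interiors of cones and quadrants *)

Lemma interior_cone (R : realType) (p d : 'rV[R]_2) :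
  (forall i, d 0 i != 0) ->
  [set x | cone_le d p x]° =
    [set x : 'rV[R]_2 | forall i, 0 < d 0 i * (x 0 i - p 0 i)].
Proof.
move=> dn0; apply/seteqP; split=> x.
  (* An interior point remains in the cone after a small push by [- d] towards the apex, which makes
     its inequalities strict. *)
  rewrite /interior => /(nbhs_ray (- d)) hx i.
  have [t [t0 /(_ i)]] := filter_ex (filterI (@nbhs_right_gt R 0) hx).
  have : 0 < t * d 0 i ^+ 2 by rewrite mulr_gt0// exprn_even_gt0//= dn0.
  by rewrite ray_coord [(- d) 0 i]mxE; nra.
move=> hx; rewrite /interior /=.
apply: (@filter_forall _ _ _ _ (nbhs_filter x)) => i.
have ex : d 0 i * y 0 i @[y --> x] --> d 0 i * x 0 i.
  by apply: cvgMl_tmp; exact: coord_continuous.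
near=> y; apply: ltW; near: y; apply: (cvgr_gt _ ex).
by rewrite -subr_gt0 -mulrBr.
Unshelve. all: by end_near. Qed.

(* Both perturbations of x along (d_0, - d_1), a direction that leaves the two
   cones, still lie in the union. *)
Lemma interior_cone_union (R : realType) (p d : 'rV[R]_2) :
  (forall i, d 0 i != 0) ->
  ([set x | cone_le d p x] `|` [set x | cone_le (- d) p x])° `<=`
  [set x | cone_le d p x]° `|` [set x | cone_le (- d) p x]°.
Proof.
move=> dn0 x; rewrite !interior_cone//; last by move=> i; rewrite mxE oppr_eq0.
rewrite {1}/interior => hx.
pose r : 'rV[R]_2 := \row_i if i == 0 then d 0 0 else - d 0 1.
have r0 : r 0 0 = d 0 0 by rewrite mxE.
have r1 : r 0 1 = - d 0 1 by rewrite mxE.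
have [t [t0 [hp hm]]] := filter_ex (filterI (@nbhs_right_gt R 0)
  (filterI (nbhs_ray r hx) (nbhs_ray (- r) hx))).
have d0 : 0 < t * d 0 0 ^+ 2 by rewrite mulr_gt0// exprn_even_gt0//= dn0.
have d1 : 0 < t * d 0 1 ^+ 2 by rewrite mulr_gt0// exprn_even_gt0//= dn0.
have N0 (q : 'rV[R]_2) i : (- q) 0 i = - q 0 i by rewrite mxE.
case: hp => hp; case: hm => hm;
  move: (hp 0) (hp 1) (hm 0) (hm 1); rewrite !ray_coord !N0 r0 r1 => A B C E.
- by left; apply: forall_ord2; nra.
- by exfalso; nra.
- by exfalso; nra.
- by right; apply: forall_ord2; rewrite N0; nra.
Qed.

Lemma quadrant4_cone (R : realType) (p d : 'rV[R]_2) :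
  0 < d 0 0 -> d 0 1 < 0 -> quadrant4 p = [set x | cone_le d p x].
Proof.
move=> d0 d1; apply/seteqP; split=> x; first by move/(cone_le_se _ _ d0 d1).
by move/(cone_le_se _ _ d0 d1).
Qed.

Lemma quadrant2_cone (R : realType) (p d : 'rV[R]_2) :
  0 < d 0 0 -> d 0 1 < 0 -> quadrant2 p = [set x | cone_le (- d) p x].
Proof.
move=> d0 d1; apply/seteqP; split=> x.
  by move=> h; apply/cone_leN/(cone_le_se _ _ d0 d1).
by move/cone_leN/(cone_le_se _ _ d0 d1).
Qed.

(** * The local dynamics at the fixed point *)

Theorem theorem6 (R : realType) (D : set 'rV[R]_2)
    (T : 'rV[R]_2 -> 'rV[R]_2) (xbar : 'rV[R]_2)
    (hD : rectangular D) (hT : map_on D T) (hcomp : competitive D T)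
    (hfix : isolated_fixed_point D T xbar)
    (hQ : D `&` (quadrant2 xbar `|` quadrant4 xbar)° !=set0)
    (F : 'rV[R]_2 -> 'rV[R]_2) (hF : C1_extension_near D T xbar F)
    (v : 'rV[R]_2) (mu : R) (hv : jacobian_eigenvector F xbar v mu)
    (hneg : v 0 0 * v 0 1 < 0) :
  exists I : set 'rV[R]_2,
    [/\ order_interval I, relative_nbhs D xbar I &
      forall U : set 'rV[R]_2, relative_nbhs D xbar U -> U `<=` I ->
        (1 < mu ->
          [/\ D `&` (quadrant2 xbar)° !=set0 ->
                exists2 z, (U `&` (quadrant2 xbar)°) z & subsolution T z,
              D `&` (quadrant4 xbar)° !=set0 ->
                exists2 z, (U `&` (quadrant4 xbar)°) z & supersolution T z &
              forall x, (I `&` (quadrant2 xbar `|` quadrant4 xbar)°) x ->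
                exists N : nat, forall n : nat, (N <= n)%N ->
                  ~ I (iter n T x)]) /\
        (mu < 1 ->
          [/\ D `&` (quadrant2 xbar)° !=set0 ->
                exists2 z, (U `&` (quadrant2 xbar)°) z & supersolution T z,
              D `&` (quadrant4 xbar)° !=set0 ->
                exists2 z, (U `&` (quadrant4 xbar)°) z & subsolution T z &
              forall x, I x -> iter n T x @[n --> \oo] --> xbar])].
Proof.
have [d [d0 d1 dA]] : exists d : 'rV[R]_2,
    [/\ 0 < d 0 0, d 0 1 < 0 & d *m jacobian F xbar = mu *: d].
  have [_ /eigenspaceP vA] := hv.
  have [v0|v0|v0] := ltgtP (v 0 0) 0.
  - exists (- v); rewrite !mxE mulNmx vA scalerN oppr_gt0 oppr_lt0; split=> //.
    by rewrite -(nmulr_rlt0 _ v0).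
  - by exists v; split=> //; rewrite -(pmulr_rlt0 _ v0).
  - by move: hneg; rewrite v0 mul0r ltxx.
have dneg : d 0 0 * d 0 1 < 0 by rewrite pmulr_rlt0.
have dn0 i : d 0 i != 0 := coord_neq0 i dneg.
have Ndn0 i : (- d) 0 i != 0 by rewrite mxE oppr_eq0.
have Ndneg : (- d) 0 0 * (- d) 0 1 < 0 by rewrite !mxE mulrNN.
have NdA : - d *m jacobian F xbar = mu *: - d by rewrite mulNmx dA scalerN.
have [DT cT] := hT.
have [/set_mem[Dp Tp] [W nW WE]] := hfix.
have [V [oV Vp C1F FT]] := hF.
have nV : nbhs xbar V by exact: open_nbhs_nbhs.
have [dF _] := C1F _ Vp.
have mT (e : 'rV[R]_2) : e 0 0 * e 0 1 < 0 -> forall z w, D z -> D w ->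
    cone_le e z w -> cone_le e (T z) (T w).
  by move=> eneg z w Dz Dw; exact: (cone_le_competitive hD hcomp eneg Dz Dw).
rewrite (quadrant4_cone _ d0 d1) (quadrant2_cone _ d0 d1) setUC in hQ *.
(* A point of [D] in an open quadrant differs from [xbar] in both coordinates; this gives the sign
   of both off-diagonal Jacobian entries. *)
have nd i : exists2 z, D z & z 0 i != xbar 0 i.
  have [x [Dx /(interior_cone_union dn0) ix]] := hQ; exists x => //.
  move: ix; rewrite !interior_cone// => -[] /(_ i);
    by apply: contraTneq => ->; rewrite subrr mulr0 ltxx.
pose a t := xbar + t *: clip D xbar (- d).
pose b t := xbar + t *: clip D xbar d.
(* One scale [t], fixed before [U], serves all purposes: [W] contains no fixed point in [D] other
   than [xbar], so neither does the box. *)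
have [t [t0 Da Db boxW contr]] : exists t : R, [/\ 0 < t, D (a t), D (b t),
    cone_box d (a t) (b t) `<=` W & mu < 1 ->
    cone_le (- d) (T (a t)) (a t) /\ cone_le d (T (b t)) (b t)].
  have contr : \forall t \near (0 : R)^'+, mu < 1 ->
      cone_le (- d) (T (a t)) (a t) /\ cone_le d (T (b t)) (b t).
    have [mu1|_] := boolP (mu < 1); last exact: nearW.
    near=> t => _; split; near: t.
      exact: (clip_ray_contracted hD hcomp DT Dp Tp dF nV FT nd NdA Ndneg mu1).
    exact: (clip_ray_contracted hD hcomp DT Dp Tp dF nV FT nd dA dneg mu1).
  apply: (@filter_ex _ (0 : R)^'+); near=> t; split.
  - by near: t; exact: nbhs_right_gt.
  - by near: t; exact: clip_ray_in.
  - by near: t; exact: clip_ray_in.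
  - by near: t; exact: near_clip_box_sub.
  - by near: t.
have boxD : cone_box d (a t) (b t) `<=` D by exact: cone_box_sub.
have boxn : relative_nbhs D xbar (cone_box d (a t) (b t)).
  exact: relative_nbhs_clip_box.
have boxp : cone_box d (a t) (b t) xbar by exact: nbhs_singleton boxn.2 Dp.
have fixb l : cone_box d (a t) (b t) l -> T l = l -> l = xbar.
  move=> bl Tl; have : (W `&` [set z | D z /\ T z = z]) l.
    by split; [exact: boxW|split=> //; exact: boxD].
  by rewrite WE.
exists (cone_box d (a t) (b t)); split=> //.
  exists (a t), (b t); apply/seteqP.
  by split=> x [/(cone_le_se _ _ d0 d1) h1 /(cone_le_se _ _ d0 d1) h2].
move=> U [UD nU] Ubox.
(* When [xbar] is on the boundary, an open quadrant may miss [D]. If it meets [D], neither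
   coordinate is blocked on that side and the eigendirection itself can be followed. *)
have clipE (e : 'rV[R]_2) : (forall i, e 0 i != 0) ->
    D `&` [set x | cone_le e xbar x]° !=set0 -> clip D xbar e = e.
  by move=> en0 [x [Dx]]; rewrite interior_cone//; exact: clip_id.
have near_U (e : 'rV[R]_2) : (forall i, e 0 i != 0) -> clip D xbar e = e ->
    \forall s \near 0^'+, (U `&` [set x | cone_le e xbar x]°) (xbar + s *: e).
  move=> en0 ce; near=> s.
  have s0 : 0 < s by near: s; exact: nbhs_right_gt.
  have Ds : D (xbar + s *: e) by rewrite -ce; near: s; exact: clip_ray_in.
  split.
    by move: Ds; near: s; exact: (nbhs_ray e nU).
  rewrite interior_cone// => i; rewrite ray_coord addrAC subrr add0r.
  by rewrite mulrCA mulr_gt0// -expr2 exprn_even_gt0//= en0.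
split=> mu1.
- have super (e : 'rV[R]_2) : (forall i, e 0 i != 0) -> e 0 0 * e 0 1 < 0 ->
      e *m jacobian F xbar = mu *: e ->
      D `&` [set x | cone_le e xbar x]° !=set0 ->
      exists2 z, (U `&` [set x | cone_le e xbar x]°) z & cone_le e z (T z).
    move=> en0 eneg eA /(clipE e en0) ce.
    have [s [Us Ts]] := filter_ex (filterI (near_U e en0 ce)
      (ray_expanded hD Dp Tp dF nV FT eA eneg mu1 ce)).
    by exists (xbar + s *: e).
  (* The corners are left free so that the claim also applies to [- d], for which they are
     swapped. *)
  have leave (e a' b' : 'rV[R]_2) : (forall i, e 0 i != 0) -> e 0 0 * e 0 1 < 0 ->
      e *m jacobian F xbar = mu *: e ->
      cone_box e a' b' = cone_box d (a t) (b t) ->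
      forall x, D x -> [set x | cone_le e xbar x]° x ->
      exists N, forall n, (N <= n)%N -> ~ cone_box e a' b' (iter n T x).
    move=> en0 eneg eA bE x Dx ix.
    have ce : clip D xbar e = e by apply: clipE => //; exists x.
    (* As [x] is interior to the cone at [xbar], [xbar] is interior to the reversed cone at [x]; ray
       points close to [xbar] therefore lie below [x]. *)
    have : \forall s \near (0 : R)^'+, cone_le e (xbar + s *: e) x.
      have nx : [set y | cone_le (- e) x y]° xbar.
        rewrite interior_cone; last first.
          by move=> i; rewrite mxE oppr_eq0.
        move=> i; move: ix; rewrite interior_cone// => /(_ i).
        by rewrite [(- e) 0 i]mxE; nra.
      by apply: filterS (nbhs_ray e nx) => s /cone_leN.
    move=> nx.
    have [s [[Us is_] [Ts sx]]] := filter_ex (filterI (near_U e en0 ce)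
      (filterI (ray_expanded hD Dp Tp dF nV FT eA eneg mu1 ce) nx)).
    apply: (increasing_orbit_leaves en0 cT DT (mT e eneg) _ _ _ _ _
      (UD _ Us) Ts Dx sx).
    + by rewrite bE.
    + by rewrite bE; exact: fixb.
    + by move: boxp; rewrite -bE => -[].
    + exact: interior_subset is_.
    + move=> sp; move: is_; rewrite sp interior_cone// => /(_ 0).
      by rewrite subrr mulr0 ltxx.
  split.
  - move=> /(super _ Ndn0 Ndneg NdA)[z Uz zT]; exists z => //.
    by apply/(cone_le_se _ _ d0 d1)/cone_leN.
  - move=> /(super _ dn0 dneg dA)[z Uz zT]; exists z => //.
    by apply/(cone_le_se _ _ d0 d1).
  - move=> x [/boxD Dx /(interior_cone_union dn0)[]] ix.
      exact: (leave d).
    rewrite -cone_boxN; apply: (leave (- d)) => //; exact: cone_boxN.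
- have sub (e : 'rV[R]_2) : (forall i, e 0 i != 0) -> e 0 0 * e 0 1 < 0 ->
      e *m jacobian F xbar = mu *: e ->
      D `&` [set x | cone_le e xbar x]° !=set0 ->
      exists2 z, (U `&` [set x | cone_le e xbar x]°) z & cone_le e (T z) z.
    move=> en0 eneg eA /(clipE e en0) ce.
    have contracted := clip_ray_contracted hD hcomp DT Dp Tp dF nV FT
      nd eA eneg mu1.
    rewrite ce in contracted.
    have [s [Us Ts]] := filter_ex (filterI (near_U e en0 ce) contracted).
    by exists (xbar + s *: e).
  split.
  - move=> /(sub _ Ndn0 Ndneg NdA)[z Uz zT]; exists z => //.
    by apply/(cone_le_se _ _ d0 d1)/cone_leN.
  - move=> /(sub _ dn0 dneg dA)[z Uz zT]; exists z => //.
    by apply/(cone_le_se _ _ d0 d1).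
  - move=> x bx; have Dx := boxD _ bx; have [ax xb] := bx.
    have [/cone_leN Ta Tb] := contr mu1.
    have cva : iter n T (a t) @[n --> \oo] --> xbar.
      exact: (increasing_orbit_cvg_fix dn0 cT DT (mT d dneg) boxD
        fixb boxp Tp Ta).
    have cvb : iter n T (b t) @[n --> \oo] --> xbar.
      (* In the order of [- d] the lower corner of the box is [b t], so its orbit is increasing
         too. *)
      rewrite -cone_boxN in boxD fixb boxp.
      apply: (increasing_orbit_cvg_fix Ndn0 cT DT (mT _ Ndneg) boxD fixb boxp Tp).
      by apply/cone_leN.
    apply: cvg_rV2 => i.
    (* The order bounds concern coordinates weighted by [d], so the weight is inserted for the
       squeeze and divided out in the limit. *)
    rewrite (_ : (fun n => _) =
        (fun n => (d 0 i)^-1 * (d 0 i * (iter n T x) 0 i))); last first.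
      by apply/funext => n; rewrite mulKf.
    rewrite -[X in _ --> X](mulKf (dn0 i)); apply: cvgMl_tmp.
    have mul_cvg (u : nat -> 'rV[R]_2) : u n @[n --> \oo] --> xbar ->
        d 0 i * u n 0 i @[n --> \oo] --> d 0 i * xbar 0 i.
      by move=> /cvg_coord ux; exact: cvgMl_tmp.
    apply: (squeeze_cvgr _ (mul_cvg _ cva) (mul_cvg _ cvb)).
    apply: nearW => n; apply/andP; split.
      exact: (iter_cone_le n DT (mT d dneg) Da Dx ax).
    exact: (iter_cone_le n DT (mT d dneg) Dx Db xb).
Unshelve. all: by end_near. Qed.
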